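(* Let $\mathcal{M}_\Sigma$ be a trace monoid, let $p\in(0,p_\Sigma)$ and let $a_1\in\Sigma$. Then $\mu_{\Sigma\setminus\{a_1\}}(p)>0$, and the real number $$r=p\,\frac{\mu_{\Sigma\setminus\mathscr{L}(a_1)}(p)}{\mu_{\Sigma\setminus\{a_1\}}(p)}$$ satisfies $r=1-\mu_\Sigma(p)/\mu_{\Sigma\setminus\{a_1\}}(p)$. Furthermore, let $T\subseteq\Sigma$ with $a_1\in T$, let $\xi$ be a random trace with law $D^{p}_{\Sigma,T}$, and let $\xi=U_0\cdot\ldots\cdot U_K$ be its decomposition with $U_0,\dots,U_{K-1}\in\mathrm{Pyr}(a_1)$ and $U_K\in\mathcal{M}_{\Sigma\setminus\{a_1\}}$ (so $K=|\xi|_{a_1}$). Then: (1) $K$ is geometric with parameter $r$: $\mathbb{P}(K=k)=(1-r)r^k$ for all integers $k\geqslant0$; (2) for every $k\geqslant0$, conditionally on $\{K=k\}$: (a) $U_0,\dots,U_k$ are independent; (b) each of the traces $U_i\cdot a_1^{-1}$ for $0\leqslant i\leqslant k-1$ (i.e. the unique trace $w$ with $U_i=w\cdot a_1$) has law $D^{p}_{\Sigma\setminus\{a_1\},\mathscr{L}(a_1)}$; (c) $U_k$ has law $D^{p}_{\Sigma\setminus\{a_1\},T}$.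
   Context: Let $\Sigma$ be a finite alphabet and $\mathcal{R}$ a reflexive and symmetric binary relation on $\Sigma$. The trace monoid $\mathcal{M}_\Sigma$ is the quotient of $\Sigma^*$ by the congruence generated by $ab=ba$ for all $(a,b)\notin\mathcal{R}$; the unit is $\mathbf{e}$. For $\Sigma'\subseteq\Sigma$, $\mathcal{M}_{\Sigma'}$ is the submonoid generated by $\Sigma'$. $|x|$ is the length of $x$, $|x|_a$ the number of occurrences of $a$, and $\max(x)$ the set of letters $a$ with $x=y\cdot a$ for some trace $y$. $\mathscr{L}(a)=\{b\in\Sigma:(a,b)\in\mathcal{R}\}$. $\mathrm{Pyr}(a_1)=\{z\cdot a_1: z\in\mathcal{M}_{\Sigma\setminus\{a_1\}},\ \max(z)\subseteq\mathscr{L}(a_1)\}$; every trace has a unique factorization $u_0\cdots u_k$ with $u_0,\dots,u_{k-1}\in\mathrm{Pyr}(a_1)$, $u_k\in\mathcal{M}_{\Sigma\setminus\{a_1\}}$. For $S\subseteq\Sigma$, a clique of $S$ is a subset of $S$ of pairwise non-$\mathcal{R}$-related letters (empty set included); $\mu_S(X)=\sum_{\gamma\text{ clique of }S}(-1)^{|\gamma|}X^{|\gamma|}$, $\mu_\emptyset=1$. For $S\neq\emptyset$, $p_S$ is the unique root of smallest modulus of $\mu_S$ (real, $0<p_S\leqslant1$); $p_\emptyset=+\infty$. For $p\in(0,p_S)$, $\sum_{x\in\mathcal{M}_S}p^{|x|}=1/\mu_S(p)<\infty$ and $B_{S,p}$ is the probability distribution on $\mathcal{M}_S$ with $B_{S,p}(\{x\})=\mu_S(p)p^{|x|}$.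 For $T\subseteq\Sigma$, $D^{p}_{S,T}$ denotes the conditional distribution $B_{S,p}(\,\cdot\mid\max(\xi)\subseteq T)$ on $\mathcal{M}_S$ (this event has positive probability). *)

(* Defs.v *)
From HB Require Import structures.
From Stdlib Require Import Relations.
From mathcomp Require Import all_boot all_order all_algebra.
From mathcomp Require Import all_classical all_reals all_analysis.
From mathcomp Require Import complex.

Unset Strict Implicit.
Unset Printing Implicit Defensive.
Import Order.TTheory GRing.Theory Num.Theory.
Local Open Scope ring_scope.

(* Trace monoid M_Sig over a finite alphabet Sig, with a (reflexive,        *)
(* symmetric) relation Rel: letters a b with ~~ Rel a b commute.           *)

Definition swap1 {Sig : finType} (Rel : rel Sig) (u v : seq Sig) : Prop :=
  exists (x y : seq Sig) (a b : Sig),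
    ~~ Rel a b /\ u = x ++ a :: b :: y /\ v = x ++ b :: a :: y.

Definition treq {Sig : finType} (Rel : rel Sig) : relation (seq Sig) :=
  clos_refl_sym_trans _ (swap1 Rel).

Definition tclass {Sig : finType} (Rel : rel Sig) (w : seq Sig) : set (seq Sig) :=
  treq Rel w.

Definition trace {Sig : finType} (Rel : rel Sig) :=
  {X : set (seq Sig) | exists w, X = tclass Rel w}.

HB.instance Definition _ (Sig : finType) (Rel : rel Sig) :=
  gen_eqMixin (trace Rel).
HB.instance Definition _ (Sig : finType) (Rel : rel Sig) :=
  gen_choiceMixin (trace Rel).

Definition tr_of {Sig : finType} (Rel : rel Sig) (w : seq Sig) : trace Rel :=
  exist _ (tclass Rel w) (ex_intro _ w erefl).

Definition trep {Sig : finType} {Rel : rel Sig} (x : trace Rel) : seq Sig :=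
  proj1_sig (cid (proj2_sig x)).

Definition tone {Sig : finType} (Rel : rel Sig) : trace Rel := tr_of Rel [::].
Definition tmul {Sig : finType} {Rel : rel Sig} (x y : trace Rel) : trace Rel :=
  tr_of Rel (trep x ++ trep y).

Definition tlen {Sig : finType} {Rel : rel Sig} (x : trace Rel) : nat :=
  size (trep x).
Definition tcount {Sig : finType} {Rel : rel Sig} (a : Sig) (x : trace Rel) : nat :=
  count_mem a (trep x).

Definition inM {Sig : finType} {Rel : rel Sig} (S : {set Sig}) (x : trace Rel) : bool :=
  all (fun a => a \in S) (trep x).

Definition is_max {Sig : finType} {Rel : rel Sig} (x : trace Rel) (a : Sig) : Prop :=
  exists y : trace Rel, x = tmul y (tr_of Rel [:: a]).

Definition max_sub {Sig : finType} {Rel : rel Sig} (x : trace Rel) (T : {set Sig}) : Prop :=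
  forall a, is_max x a -> a \in T.

Definition Lnb {Sig : finType} (Rel : rel Sig) (a : Sig) : {set Sig} :=
  [set b | Rel a b].

Definition clique {Sig : finType} (Rel : rel Sig) (S g : {set Sig}) : bool :=
  (g \subset S) && [forall a in g, forall b in g, (a != b) ==> ~~ Rel a b].

Definition mu {Sig : finType} (Rel : rel Sig) {K : comPzRingType}
    (S : {set Sig}) (X : K) : K :=
  \sum_(g : {set Sig} | clique Rel S g) (-1) ^+ #|g| * X ^+ #|g|.

(* p < p_S, where p_S is the root of smallest modulus of mu_S
   (p_S = +oo when mu_S has no root): every complex root has modulus > p *)
Definition lt_pS {Sig : finType} (Rel : rel Sig) {R : realType}
    (S : {set Sig}) (p : R) : Prop :=
  forall z : R[i], mu Rel S z = 0 -> (p%:C)%C < `|z|.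

Definition Pr {Sig : finType} {Rel : rel Sig} {R : realType}
    (P : trace Rel -> R) (E : set (trace Rel)) : R :=
  fine (\esum_(x in E) (P x)%:E).

Definition condPr {Sig : finType} {Rel : rel Sig} {R : realType}
    (P : trace Rel -> R) (E F : set (trace Rel)) : R :=
  Pr P (setI E F) / Pr P F.

Definition Bpmf {Sig : finType} (Rel : rel Sig) {R : realType}
    (S : {set Sig}) (p : R) (x : trace Rel) : R :=
  if inM S x then mu Rel S p * p ^+ tlen x else 0.

Definition Dpmf {Sig : finType} (Rel : rel Sig) {R : realType}
    (S T : {set Sig}) (p : R) (x : trace Rel) : R :=
  condPr (Bpmf Rel S p) (fun y => y = x) (fun y => max_sub y T).

Definition Pyr {Sig : finType} (Rel : rel Sig) (a1 : Sig) (x : trace Rel) : Prop :=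
  exists z : trace Rel, inM [set~ a1] z /\ max_sub z (Lnb Rel a1) /\
    x = tmul z (tr_of Rel [:: a1]).

Definition is_pyrdec {Sig : finType} (Rel : rel Sig) (a1 : Sig)
    (x : trace Rel) (us : seq (trace Rel)) : Prop :=
  [/\ (0 < size us)%N,
      forall i, (i < (size us).-1)%N -> Pyr Rel a1 (nth (tone Rel) us i),
      inM [set~ a1] (last (tone Rel) us)
    & x = foldr tmul (tone Rel) us].

Definition pyrdec {Sig : finType} (Rel : rel Sig) (a1 : Sig) (x : trace Rel)
    : seq (trace Rel) :=
  xget [::] (is_pyrdec Rel a1 x).

Definition Kdec {Sig : finType} (Rel : rel Sig) (a1 : Sig) (x : trace Rel) : nat :=
  (size (pyrdec Rel a1 x)).-1.
Definition Udec {Sig : finType} (Rel : rel Sig) (a1 : Sig) (i : nat)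
    (x : trace Rel) : trace Rel :=
  nth (tone Rel) (pyrdec Rel a1 x) i.

Definition rdiv {Sig : finType} (Rel : rel Sig) (a1 : Sig) (u : trace Rel)
    : trace Rel :=
  xget (tone Rel) (fun w => u = tmul w (tr_of Rel [:: a1])).

(* Main.v *)
(** Traces are handled through their representing words: equality of traces is
    equality of all projections onto pairs of dependent letters, which makes the
    trace monoid cancellative, and whether a letter is maximal can be read off
    any representing word.

    Let [W T] be the sum of p^|x| over the traces x of M_S with max(x) included
    in T.  Sorting such x by whether b in T is maximal gives
    W T = W (T - b) + p W (T + L(b)), and mu_{S - T}(p) obeys the same recursion
    in T.  All mu_S(p) are positive, so truncated sums are bounded by induction on
    length, the series converges, and W T = mu_{S - T}(p) / mu_S(p).

    Pyramidal decomposition being unique and multiplicative in length, and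
    max(u_0 ... u_k) being included in T iff max(u_k) is (since a_1 is in T), the
    weight of [K = k, U_i in A_i for i <= k] factors as a product over i; every
    claim is an instance of this factorization. *)

Require Import Defs.
From Stdlib Require Import Relations.
From mathcomp Require Import all_boot all_order all_algebra.
From mathcomp Require Import all_classical all_reals all_analysis.
From mathcomp Require Import complex ring lra zify.
Set Implicit Arguments.
Unset Strict Implicit.
Import Order.TTheory GRing.Theory Num.Theory numFieldNormedType.Exports.
Local Open Scope ring_scope.

(** * Words up to commutation *)

Section Words.
Variables (Sig : finType) (Rel : rel Sig).
Hypotheses (Rrefl : reflexive Rel) (Rsym : symmetric Rel).
Implicit Types (u v w : seq Sig) (a b c : Sig).

Lemma treq_refl w : treq Rel w w. Proof. exact: rst_refl. Qed.

Lemma treq_sym u v : treq Rel u v -> treq Rel v u. Proof. exact: rst_sym. Qed.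

Lemma treq_trans v u w : treq Rel u v -> treq Rel v w -> treq Rel u w.
Proof. exact: rst_trans. Qed.

Lemma treq_swap x y a b : ~~ Rel a b ->
  treq Rel (x ++ a :: b :: y) (x ++ b :: a :: y).
Proof. by move=> ab; apply: rst_step; exists x, y, a, b. Qed.

Lemma treq_catl w u v : treq Rel u v -> treq Rel (w ++ u) (w ++ v).
Proof.
elim=> [_ _ [x [y [a [b [ab [-> ->]]]]]]|x|x y _|x y z _ xy _ yz].
- by rewrite !catA; exact: treq_swap.
- exact: treq_refl.
- exact: treq_sym.
- exact: treq_trans xy yz.
Qed.

Lemma treq_catr w u v : treq Rel u v -> treq Rel (u ++ w) (v ++ w).
Proof.
elim=> [_ _ [x [y [a [b [ab [-> ->]]]]]]|x|x y _|x y z _ xy _ yz].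
- by rewrite -!catA; exact: treq_swap.
- exact: treq_refl.
- exact: treq_sym.
- exact: treq_trans xy yz.
Qed.

Lemma treq_cat u u' v v' :
  treq Rel u u' -> treq Rel v v' -> treq Rel (u ++ v) (u' ++ v').
Proof.
by move=> /(treq_catr v) uu' /(treq_catl u') vv'; exact: treq_trans uu' vv'.
Qed.

Lemma treq_move a w : all (fun c => ~~ Rel a c) w ->
  treq Rel (a :: w) (w ++ [:: a]).
Proof.
elim: w => [_|b w IHw /= /andP[ab /IHw aw]]; first exact: treq_refl.
exact: treq_trans (@treq_swap [::] w _ _ ab) (treq_catl [:: b] aw).
Qed.

Lemma treq_invariant {T : Type} (f : seq Sig -> T) :
  (forall x y a b, ~~ Rel a b -> f (x ++ a :: b :: y) = f (x ++ b :: a :: y)) ->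
  forall u v, treq Rel u v -> f u = f v.
Proof.
move=> fswap u v; elim=> [_ _ [x [y [a [b [ab [-> ->]]]]]]|//|//|x y z _ -> _ -> //].
exact: fswap.
Qed.

Lemma treq_perm u v : treq Rel u v -> perm_eq u v.
Proof.
move=> uv; apply/permP => P; move: u v uv; apply: treq_invariant => x y a b _.
by rewrite !count_cat /= [(P a + _)%N]addnCA.
Qed.

Definition proj a b w := [seq c <- w | pred2 a b c].

Lemma proj_cat a b u v : proj a b (u ++ v) = proj a b u ++ proj a b v.
Proof. exact: filter_cat. Qed.

Lemma treq_proj u v a b : Rel a b -> treq Rel u v -> proj a b u = proj a b v.
Proof.
move=> ab; move: u v; apply: treq_invariant => x y c d cd.
rewrite !proj_cat; congr (_ ++ _); rewrite /proj /=.
(* Two swapped letters cannot both survive the projection: they would be dependent. *)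
case: (c =P a) (c =P b) (d =P a) (d =P b) => [ca|_] [cb|_] [da|_] [db|_] //=;
  subst; by rewrite ?Rrefl ?ab ?(Rsym b) ?ab in cd.
Qed.

(* A trace is determined by its projections onto the pairs of dependent
   letters; cancellation in the trace monoid is cancellation of words in each
   projection. *)
Lemma proj_treq u v : (forall a b, Rel a b -> proj a b u = proj a b v) ->
  treq Rel u v.
Proof.
elim: u v => [|c u IHu] v uv.
  case: v uv => [_|b v /(_ b b (Rrefl b))]; first exact: treq_refl.
  by rewrite /proj /= eqxx.
have cv : c \in v.
  have := uv c c (Rrefl c); rewrite /proj /= eqxx /= => uvc.
  have : c \in [seq d <- v | (d == c) || (d == c)] by rewrite -uvc mem_head.
  by rewrite mem_filter => /andP[].
have [v1 [v2 [vE cv1]]] : exists v1 v2, v = v1 ++ c :: v2 /\ c \notin v1.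
  elim: v cv {uv} => // b v IHv; rewrite inE; have [<- _|cb /= cv] := eqVneq c b.
    by exists [::], v.
  have [v1 [v2 [-> cv1]]] := IHv cv; exists (b :: v1), v2; split=> //.
  by rewrite inE negb_or cb.
(* If a letter [d] of [v1] depended on [c], the projection of [v] onto [c] and [d] would start
   inside [v1], hence not with [c], while that of [u] starts with [c]. *)
have comm : all (fun d => ~~ Rel c d) v1.
  apply/allP => d dv1; apply/negP => cd; have := uv c d cd.
  rewrite vE proj_cat /proj /= eqxx /=.
  case E : [seq e <- v1 | _] => [|e s].
    suff : d \in [::] by [].
    by rewrite -E mem_filter eqxx orbT.
  case=> ce _; move: cv1; have : e \in e :: s by rewrite mem_head.
  by rewrite -E mem_filter -ce => /andP[_ ->].
have vc : treq Rel v (c :: v1 ++ v2).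
  rewrite vE -cat1s catA -(cat_cons c v1 v2); apply: treq_catr.
  exact/treq_sym/treq_move.
apply: treq_trans (treq_sym vc); apply: (treq_catl [:: c]); apply: IHu => a b ab.
have := uv a b ab; rewrite (treq_proj ab vc) /proj /=.
by case: ifP => // _ [].
Qed.

Lemma treq_catIr w u v : treq Rel (u ++ w) (v ++ w) -> treq Rel u v.
Proof.
move=> uwvw; apply: proj_treq => a b ab; move/eqP: (treq_proj ab uwvw).
rewrite !proj_cat eqseq_cat => [/andP[/eqP]//|].
have := congr1 size (treq_proj ab uwvw).
by rewrite !proj_cat !size_cat => /addIn.
Qed.

(** Tests whether some occurrence of [a] commutes with every letter to its right, so that it can be
    moved to the end. *)
Fixpoint wmax w a := if w is b :: w' then
  wmax w' a || ((b == a) && all (fun c => ~~ Rel a c) w') else false.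

Lemma wmax_cat u v a :
  wmax (u ++ v) a = wmax v a || (wmax u a && all (fun c => ~~ Rel a c) v).
Proof.
elim: u => [|b u IHu] /=; first by rewrite orbF.
rewrite IHu all_cat; case: (wmax v a) (wmax u a) (all _ v) => [] [] [] //=.
all: by rewrite ?andbT ?andbF.
Qed.

Lemma treq_wmax u v a : treq Rel u v -> wmax u a = wmax v a.
Proof.
move: u v; refine (treq_invariant (f := fun w => wmax w a) _) => x y b c bc.
rewrite -[b :: c :: y]/([:: b; c] ++ y) -[c :: b :: y]/([:: c; b] ++ y).
rewrite !wmax_cat !all_cat /= !andbT; congr (_ || _ && _ || _ && _).
- case: (b =P a) (c =P a) => [ba|_] [ca|_] //=; subst; rewrite ?bc //.
  by rewrite Rsym bc.
- by case: (~~ Rel a b) (~~ Rel a c) => [] [].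
Qed.

Lemma wmaxP w a : reflect (exists w', treq Rel w (w' ++ [:: a])) (wmax w a).
Proof.
apply: (iffP idP) => [|[w' /(treq_wmax a)->]]; last first.
  by rewrite wmax_cat /= eqxx.
elim: w => //= b w IHw /orP[/IHw[w' ww']|/andP[/eqP-> /treq_move ?]].
  by exists (b :: w'); exact: (treq_catl [:: b]).
by exists w.
Qed.

Lemma wmax_mem w a : wmax w a -> a \in w.
Proof.
elim: w => //= b w IHw /orP[/IHw aw|/andP[/eqP->]]; rewrite inE ?eqxx //.
by rewrite aw orbT.
Qed.

End Words.

(** * The trace monoid *)

Section Traces.
Variables (Sig : finType) (Rel : rel Sig).
Hypotheses (Rrefl : reflexive Rel) (Rsym : symmetric Rel).
Implicit Types (a b c : Sig) (S T : {set Sig}).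
Implicit Types (x y z : trace Rel).

Let tr a : trace Rel := tr_of Rel [:: a].

Lemma tr_of_eq u v : tr_of Rel u = tr_of Rel v <-> treq Rel u v.
Proof.
split=> [[uv]|uv].
  suff : tclass Rel u v by []. by rewrite uv; exact: treq_refl.
apply: eq_exist; apply/seteqP; split=> w; first exact/treq_trans/treq_sym.
exact: treq_trans.
Qed.

Lemma trepK x : tr_of Rel (trep x) = x.
Proof.
case: x => X wX; apply: eq_exist; rewrite /trep /=.
by case: (cid wX) => w /= ->.
Qed.

Lemma trep_tr w : treq Rel (trep (tr_of Rel w)) w.
Proof. by apply/tr_of_eq; rewrite trepK. Qed.

Lemma tmul_tr u v : tmul (tr_of Rel u) (tr_of Rel v) = tr_of Rel (u ++ v).
Proof. by apply/tr_of_eq/treq_cat; exact: trep_tr. Qed.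

Lemma tmulA x y z : tmul x (tmul y z) = tmul (tmul x y) z.
Proof.
by rewrite -(trepK x) -(trepK y) -(trepK z) !tmul_tr catA.
Qed.

Lemma tmul1 x : tmul (tone Rel) x = x.
Proof. by rewrite -(trepK x) tmul_tr. Qed.

Lemma tmulr1 x : tmul x (tone Rel) = x.
Proof. by rewrite -(trepK x) tmul_tr cats0. Qed.

Lemma tmulIr z x y : tmul x z = tmul y z -> x = y.
Proof.
rewrite -(trepK x) -(trepK y) -(trepK z) !tmul_tr => /tr_of_eq xy.
exact/tr_of_eq/(treq_catIr Rrefl Rsym xy).
Qed.

Lemma trep_perm w : perm_eq (trep (tr_of Rel w)) w.
Proof. exact/treq_perm/trep_tr. Qed.

Lemma tlen_tr w : tlen (tr_of Rel w) = size w.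
Proof. exact/perm_size/trep_perm. Qed.

Lemma tlen_mul x y : tlen (tmul x y) = (tlen x + tlen y)%N.
Proof. by rewrite tlen_tr size_cat. Qed.

Lemma tcount_tr a w : tcount a (tr_of Rel w) = count_mem a w.
Proof. by move/permP: (trep_perm w); apply. Qed.

Lemma tcount_mul a x y : tcount a (tmul x y) = (tcount a x + tcount a y)%N.
Proof. by rewrite tcount_tr count_cat. Qed.

Lemma tcount1 a : tcount a (tone Rel) = 0%N. Proof. exact: tcount_tr. Qed.

Lemma inM_tr S w : inM S (tr_of Rel w) = all (mem S) w.
Proof. exact/perm_all/trep_perm. Qed.

Lemma inM_mul S x y : inM S (tmul x y) = inM S x && inM S y.
Proof. by rewrite inM_tr all_cat. Qed.

Lemma inMT x : inM [set: Sig] x.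
Proof. by apply/allP => a _; rewrite inE. Qed.

Lemma inMC1 a x : inM [set~ a] x = (tcount a x == 0%N).
Proof.
rewrite /inM /tcount; elim: (trep x) => //= b w ->.
by rewrite !inE; case: eqP.
Qed.

Definition tmax x a := wmax Rel (trep x) a.

Lemma tmax_tr w a : tmax (tr_of Rel w) a = wmax Rel w a.
Proof. exact/(treq_wmax Rsym)/trep_tr. Qed.

Lemma tmaxP x a : reflect (is_max x a) (tmax x a).
Proof.
apply: (iffP (wmaxP Rsym _ _)) => [[w xw]|[y xy]].
  by exists (tr_of Rel w); rewrite tmul_tr -(trepK x); apply/tr_of_eq.
by exists (trep y); apply/tr_of_eq; rewrite trepK xy -{1}(trepK y) tmul_tr.
Qed.

Lemma max_subP x T : max_sub x T <-> forall a, tmax x a -> a \in T.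
Proof. by split=> xT a /tmaxP; exact: xT. Qed.

Lemma tmax_mul x y a :
  tmax (tmul x y) a = tmax y a || (tmax x a && inM (~: Lnb Rel a) y).
Proof.
rewrite tmax_tr wmax_cat /tmax /inM; congr (_ || _ && _).
by apply: eq_all => b; rewrite !inE.
Qed.

Lemma tmax_letter a b : tmax (tr a) b = (a == b).
Proof. by rewrite tmax_tr /= andbT. Qed.

Lemma tmax_inM S x a : inM S x -> tmax x a -> a \in S.
Proof. by move=> /allP xS /wmax_mem; exact: xS. Qed.

(** By reflexivity [a] does not commute with itself. *)
Lemma inM_comm a x : inM (~: Lnb Rel a) x -> tcount a x = 0%N.
Proof.
move=> /allP xa; apply: count_memPn; apply/negP => /xa.
by rewrite !inE Rrefl.
Qed.

Lemma trace_maxP x : x = tone Rel \/ exists a, tmax x a.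
Proof.
rewrite -(trepK x); case/lastP: (trep x) => [|w a]; [by left|right; exists a].
by rewrite tmax_tr -cats1 wmax_cat /= eqxx.
Qed.

Lemma inM1 S : inM S (tone Rel). Proof. by rewrite inM_tr. Qed.

Lemma tmax1 a : tmax (tone Rel) a = false. Proof. by rewrite tmax_tr. Qed.

Lemma trace_ind_max (P : trace Rel -> Prop) :
  P (tone Rel) -> (forall y a, P y -> P (tmul y (tr a))) -> forall x, P x.
Proof.
move=> P1 PM x; rewrite -(trepK x); elim/last_ind: (trep x) => // w a.
by rewrite -cats1 -tmul_tr; exact: PM.
Qed.

(** * Pyramids and the pyramidal decomposition *)

Section Pyramids.
Variable a1 : Sig.

(** What is left of a pyramid once its apex [a1] is removed. *)
Definition preP x := inM [set~ a1] x /\ max_sub x (Lnb Rel a1).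

Lemma PyrP u : Pyr Rel a1 u <-> exists2 w, preP w & u = tmul w (tr a1).
Proof. by split=> [[w [? [? ->]]]|[w [? ?] ->]]; exists w. Qed.

Lemma tcount_preP w : preP w -> tcount a1 w = 0%N.
Proof. by case=> /[!inMC1] /eqP. Qed.

Lemma tcount_Pyr u : Pyr Rel a1 u -> tcount a1 u = 1%N.
Proof.
by move=> /PyrP[w /tcount_preP w0 ->]; rewrite tcount_mul w0 tcount_tr /= eqxx.
Qed.

(** A maximal letter of the base depends on the apex, which therefore blocks it. *)
Lemma tmax_Pyr u b : Pyr Rel a1 u -> tmax u b = (a1 == b).
Proof.
move=> /PyrP[w [_ /max_subP wL] ->]; rewrite tmax_mul tmax_letter.
apply/orP/idP => [[//|/andP[/wL]]|]; last by left.
by rewrite inM_tr /= !inE Rsym => ->.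
Qed.

(** The pyramid can only contribute its apex, and only when all of [y] commutes with it. *)
Lemma tmax_Pyr_mul u y b : Pyr Rel a1 u ->
  tmax (tmul u y) b -> tmax y b \/ b = a1 /\ tcount a1 y = 0%N.
Proof.
move=> Pu; rewrite tmax_mul (tmax_Pyr _ Pu).
by case/orP=> [->|/andP[/eqP-> /inM_comm]]; [left|right].
Qed.

(* Peel off a maximal letter of y: it is also maximal in the other product,
   hence in y', because a pyramid has a1 as its only maximal letter. *)
Lemma Pyr_mul_inj u u' y y' : Pyr Rel a1 u -> Pyr Rel a1 u' ->
  tmul u y = tmul u' y' -> u = u' /\ y = y'.
Proof.
move=> Pu Pu'; move: y y'; apply: trace_ind_max => [|y b IHy] y' E.
  have y'0 : tcount a1 y' = 0%N.
    have := congr1 (tcount a1) E.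
    by rewrite !tcount_mul (tcount_Pyr Pu) (tcount_Pyr Pu') tcount1 => -[].
  case: (trace_maxP y') => [y'1|[b y'b]].
    by move: E; rewrite y'1 !tmulr1.
  have : tmax (tmul u (tone Rel)) b by rewrite E tmax_mul y'b.
  rewrite tmulr1 tmax_Pyr // => /eqP ba; move/count_memPn: y'0.
  by rewrite ba (wmax_mem y'b).
have : tmax (tmul u (tmul y (tr b))) b by rewrite !tmax_mul tmax_letter eqxx.
rewrite E => /tmax_Pyr_mul[//|/tmaxP[y1 y1E]|[ba y'0]].
  rewrite y1E; move: E; rewrite y1E !tmulA => /tmulIr /IHy[-> ->].
  by [].
(* Impossible case: the left product has at least two [a1], the right one exactly one. *)
have := congr1 (tcount a1) E.
rewrite !tcount_mul (tcount_Pyr Pu) (tcount_Pyr Pu') y'0 tcount_tr ba /= eqxx.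
lia.
Qed.

(** Cut at the first [a1]. While the prefix has a maximal letter commuting with [a1], move it to the
    right of [a1]; the prefix shortens until it is the base of a pyramid. *)
Lemma exists_Pyr x : (0 < tcount a1 x)%N ->
  exists u y, Pyr Rel a1 u /\ x = tmul u y.
Proof.
move=> x0; have [v [y [v0 xE]]] :
    exists v y, tcount a1 v = 0%N /\ x = tmul v (tmul (tr a1) y).
  have : a1 \in trep x by rewrite -has_pred1 has_count.
  rewrite -{2}(trepK x); elim: (trep x) => // b w IHw.
  rewrite inE; have [<- _|ab /= /IHw[v [y [v0 E]]]] := eqVneq a1 b.
    by exists (tone Rel), (tr_of Rel w); rewrite tcount1 tmul1 tmul_tr.
  exists (tmul (tr b) v), y; rewrite tcount_mul tcount_tr v0 /= eq_sym.
  by rewrite (negPf ab) -tmulA -E tmul_tr.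
have [n] := ubnP (tlen v); elim: n v y v0 {x0} xE => // n IHn v y v0 xE vn.
have [vP|vNP] := pselect (max_sub v (Lnb Rel a1)).
  exists (tmul v (tr a1)), y; split; last by rewrite -tmulA.
  by exists v; rewrite inMC1 v0.
have [b [/tmaxP[v' vE] ab]] : exists b, tmax v b /\ ~~ Rel a1 b.
  have /existsNP[b] : ~ forall b, is_max v b -> b \in Lnb Rel a1 by [].
  by rewrite not_implyE inE => -[/tmaxP vb /negP ab]; exists b.
apply: (IHn v' (tmul (tr b) y)).
- by move: v0; rewrite vE tcount_mul => /eqP; rewrite addn_eq0 => /andP[/eqP].
- rewrite xE vE -!tmulA; congr tmul; rewrite !tmulA; congr tmul.
  by rewrite !tmul_tr; apply/tr_of_eq/(treq_swap [::] [::]); rewrite Rsym.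
- by move: vn; rewrite vE tlen_mul tlen_tr addn1.
Qed.

Lemma is_pyrdec1 x v :
  is_pyrdec Rel a1 x [:: v] <-> inM [set~ a1] v /\ x = v.
Proof.
split=> [[_ _ /= + ->]|[? ->]]; first by rewrite tmulr1.
by split=> //=; rewrite tmulr1.
Qed.

(** The side condition keeps [u] from being the last entry, which is not a pyramid but a trace
    without [a1]. *)
Lemma is_pyrdec_cons x u us : us != [::] ->
  is_pyrdec Rel a1 x (u :: us) <->
  Pyr Rel a1 u /\ exists2 y, is_pyrdec Rel a1 y us & x = tmul u y.
Proof.
case: us => // v us _; split=> [[_ uP lP ->]|[uP [y [_ vP lP ->] ->]]].
  split; first exact: (uP 0%N).
  exists (foldr tmul (tone Rel) (v :: us)) => //.
  by split=> // i; exact: (uP i.+1).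
by split=> // -[|i] // /vP.
Qed.

(** A single entry has no [a1] and a longer list has some, so one-entry lists only match each other;
    otherwise the first pyramid and the rest are determined by the product. *)
Lemma is_pyrdec_uniq x us us' :
  is_pyrdec Rel a1 x us -> is_pyrdec Rel a1 x us' -> us = us'.
Proof.
elim: us us' x => [|u us IHus] [|u' us'] x; try by [case|move=> _ []].
case: us IHus => [|v us] IHus; case: us' => [|v' us'].
- by move=> /is_pyrdec1[_ ->] /is_pyrdec1[_ ->].
- move=> /is_pyrdec1[+ ->] /is_pyrdec_cons[//|Pu [y _ uE]].
  by rewrite inMC1 uE tcount_mul (tcount_Pyr Pu).
- move=> + /is_pyrdec1[+ xE] => /is_pyrdec_cons[//|Pu [y _ uE]].
  by rewrite inMC1 -xE uE tcount_mul (tcount_Pyr Pu).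
move=> /is_pyrdec_cons[//|Pu [y yus ->]] /is_pyrdec_cons[//|Pu' [y' yus']].
move=> /(Pyr_mul_inj Pu Pu')[-> yE]; congr cons.
by rewrite -yE in yus'; exact: IHus yus yus'.
Qed.

Lemma pyrdecE x us : is_pyrdec Rel a1 x us -> pyrdec Rel a1 x = us.
Proof.
move=> xus; apply: (is_pyrdec_uniq _ xus).
exact: (@xgetPex _ [::] (is_pyrdec Rel a1 x) (ex_intro _ us xus)).
Qed.

Lemma pyrdec1 v : inM [set~ a1] v -> pyrdec Rel a1 v = [:: v].
Proof. by move=> va; apply/pyrdecE/is_pyrdec1. Qed.

(** Each pyramid split off uses up one [a1]. Existence rules out the default value of [xget]. *)
Lemma pyrdecP x : is_pyrdec Rel a1 x (pyrdec Rel a1 x).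
Proof.
suff [us xus] : exists us, is_pyrdec Rel a1 x us.
  exact: (@xgetPex _ [::] (is_pyrdec Rel a1 x) (ex_intro _ us xus)).
have [n] := ubnP (tcount a1 x); elim: n x => // n IHn x xn.
have [x0|] := posnP (tcount a1 x).
  by exists [:: x]; apply/is_pyrdec1; rewrite inMC1 x0.
move=> /exists_Pyr[u [y [Pu xE]]].
have [us yus] : exists us, is_pyrdec Rel a1 y us.
  by apply: IHn; move: xn; rewrite xE tcount_mul (tcount_Pyr Pu).
exists (u :: us); apply/is_pyrdec_cons; last by split=> //; exists y.
by case: us yus => // -[].
Qed.

Lemma pyrdec_mul u y : Pyr Rel a1 u ->
  pyrdec Rel a1 (tmul u y) = u :: pyrdec Rel a1 y.
Proof.
move=> Pu; apply/pyrdecE/is_pyrdec_cons.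
  by have := pyrdecP y; case: (pyrdec Rel a1 y) => // -[].
by split=> //; exists y => //; exact: pyrdecP.
Qed.

Lemma Kdec_count x : Kdec Rel a1 x = tcount a1 x.
Proof.
have := pyrdecP x; rewrite /Kdec; move: (pyrdec _ _ _) => us.
elim: us x => [|u us IHus] x; first by case.
case: us IHus => [|v us] IHus.
  by move=> /is_pyrdec1[+ ->]; rewrite inMC1 => /eqP.
move=> /is_pyrdec_cons[//|Pu [y yus ->]].
by rewrite tcount_mul (tcount_Pyr Pu) -(IHus y yus).
Qed.

Lemma max_sub_Pyr_mul u y T : Pyr Rel a1 u -> a1 \in T ->
  max_sub (tmul u y) T <-> max_sub y T.
Proof.
move=> Pu aT; rewrite !max_subP; split=> yT b.
  by move=> yb; apply: yT; rewrite tmax_mul yb.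
by move=> /(tmax_Pyr_mul Pu)[/yT|[->]].
Qed.

(** By cancellation, [xget] has only one quotient to choose. *)
Lemma rdiv_mul w : rdiv Rel a1 (tmul w (tr a1)) = w.
Proof.
rewrite /rdiv; case: xgetP => [z _ /tmulIr ->//|/(_ w)]; by case.
Qed.

End Pyramids.
End Traces.

(** * Clique polynomials *)

Section CliquePolynomials.
Variables (Sig : finType) (Rel : rel Sig).
Hypotheses (Rrefl : reflexive Rel) (Rsym : symmetric Rel).
Implicit Types (a b : Sig) (S T g : {set Sig}).

Lemma cliqueP S g : reflect (g \subset S /\
  forall a b, a \in g -> b \in g -> a != b -> ~~ Rel a b) (clique Rel S g).
Proof.
apply: (iffP andP) => -[gS gR]; split=> //.
  by move=> a b ag bg; move/forall_inP: gR => /(_ a ag)/forall_inP/(_ b bg)/implyP.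
by apply/forall_inP => a ag; apply/forall_inP => b bg; apply/implyP; exact: gR.
Qed.

(** The cliques containing [b] are the [b |: g] with [g] a clique of letters of [S] commuting with
    [b]; the extra letter accounts for the factor [- X]. *)
Lemma mu_setU1 (K : comPzRingType) S b (X : K) : b \notin S ->
  mu Rel (b |: S) X = mu Rel S X - X * mu Rel (S :\: Lnb Rel b) X.
Proof.
move=> bS; rewrite /mu (bigID (fun g => b \in g)) /= addrC; congr (_ + _).
  apply: eq_bigl => g; apply/andP/cliqueP => [[/cliqueP[gbS gR] bg]|[gS gR]].
    split=> //; apply/fintype.subsetP => c cg; move/fintype.subsetP: gbS => /(_ c cg).
    by rewrite !inE => /orP[/eqP cb|//]; rewrite cb (negPf bg) in cg.
  split; last by apply: contra bS; exact: (fintype.subsetP gS).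
  by apply/cliqueP; split=> //; apply: fintype.subset_trans gS (finset.subsetUr _ _).
rewrite (reindex_onto (fun g => b |: g) (fun g => g :\ b)) /=; last first.
  by move=> g /andP[_ bg]; rewrite finset.setD1K.
rewrite mulr_sumr -sumrN; apply: eq_big => g; last first.
  move=> /andP[_ /eqP gE]; rewrite cardsU1 -gE !inE eqxx /= gE.
  by rewrite !exprS; ring.
rewrite finset.setU11 andbT.
apply/andP/cliqueP => [[/cliqueP[gS gR] /eqP gE]|[gS gR]].
  have bg : b \notin g by rewrite -gE !inE eqxx.
  split=> [|c d cg dg]; last by apply: gR; rewrite !inE ?cg ?dg orbT.
  apply/fintype.subsetP => c cg; have cb : c != b by apply: contra bg => /eqP <-.
  rewrite !inE Rsym gR ?finset.setU11 // ?inE ?cg ?orbT //=.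
  by move/fintype.subsetP: gS => /(_ c); rewrite !inE cg orbT (negPf cb) => /(_ isT).
have bg : b \notin g.
  by apply/negP => /(fintype.subsetP gS); rewrite !inE Rrefl.
split; last by rewrite finset.setU1K.
apply/cliqueP; split=> [|c d].
  by apply: finset.setUS; apply: fintype.subset_trans gS (finset.subsetDl _ _).
have gL e : e \in g -> ~~ Rel b e.
  by move=> /(fintype.subsetP gS); rewrite !inE => /andP[].
rewrite !inE => /orP[/eqP->|cg] /orP[/eqP->|dg]; rewrite ?eqxx // => cd.
- exact: gL.
- by rewrite Rsym gL.
- exact: gR.
Qed.

Lemma mu_set0 (K : comPzRingType) (X : K) : mu Rel finset.set0 X = 1.
Proof.
rewrite /mu (bigD1 (finset.set0 : {set Sig})) /=; last first.
  by apply/cliqueP; split=> // a b; rewrite inE.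
rewrite big1 ?addr0 ?cards0 ?expr0 ?mulr1 // => g /andP[/cliqueP[]].
by rewrite finset.subset0 => ->.
Qed.

Lemma mu_setD1 (K : comPzRingType) S b (X : K) : b \in S ->
  mu Rel S X = mu Rel (S :\ b) X - X * mu Rel (S :\: Lnb Rel b) X.
Proof.
move=> bS; rewrite -{1}(finset.setD1K bS) mu_setU1 ?finset.setD11 //.
congr (_ - _ * mu _ _ _).
apply/setP => c; rewrite !inE andbA; case: (c =P b) => [->|]; rewrite ?Rrefl //.
by rewrite andbT.
Qed.

Lemma mu_at0 (K : comPzRingType) S : mu Rel S (0 : K) = 1.
Proof.
have [n] := ubnP #|S|; elim: n S => // n IHn S Sn.
have [->|[b bS]] := set_0Vmem S; first exact: mu_set0.
rewrite (mu_setD1 _ bS) mul0r subr0 IHn //.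
by rewrite (cardsD1 b) bS in Sn.
Qed.

(** Turns a real zero into a complex one, as [lt_pS] bounds complex roots. *)
Lemma mu_rmorph (K L : comPzRingType) (f : {rmorphism K -> L}) S (X : K) :
  mu Rel S (f X) = f (mu Rel S X).
Proof.
rewrite /mu rmorph_sum; apply: eq_bigr => g _.
by rewrite rmorphM !rmorphXn rmorphN1.
Qed.

(** * Positivity of the clique polynomials at p *)

Section Positivity.
Variables (R : realType) (p : R).
Hypothesis p_gt0 : 0 < p.

Lemma mu_setT_neq0 : lt_pS Rel [set: Sig] p ->
  forall t, 0 <= t <= p -> mu Rel [set: Sig] t != 0.
Proof.
move=> p_lt t /andP[t0 tp]; apply/eqP => mut.
have /p_lt : mu Rel [set: Sig] (t%:C)%C = 0.
  by rewrite (mu_rmorph (real_complex R)) mut rmorph0.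
by rewrite ger0_norm ?ler0c // ltcR ltNge tp.
Qed.

(** Adding a letter [b] to [S] subtracts [t * mu Rel (S :\: Lnb Rel b) t], which is nonnegative. *)
Lemma mu_setT_le (t : R) : 0 <= t -> (forall S, 0 <= mu Rel S t) ->
  forall S, mu Rel [set: Sig] t <= mu Rel S t.
Proof.
move=> t0 mu0 S; have [n] := ubnP #|~: S|; elim: n S => // n IHn S Sn.
have [SC|[b bS]] := set_0Vmem (~: S); first by rewrite -[S]finset.setCK SC finset.setC0.
rewrite inE in bS; apply: (@le_trans _ _ (mu Rel (b |: S) t)).
  apply: IHn; move: Sn; rewrite (cardsD1 b (~: S)) inE bS.
  by rewrite finset.setDE -finset.setCU finset.setUC.
by rewrite mu_setU1 // gerBl mulr_ge0.
Qed.

Lemma mu_continuous S : continuous (fun t : R => mu Rel S t).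
Proof.
move=> t; apply: cvg_big => [|g _]; first exact: add_continuous.
apply: cvgM; first exact: cvg_cst.
exact: exprn_continuous.
Qed.

(* At a zero t of the minimum of all the mu_S on [0, p], every mu_S is
   nonnegative and one of them vanishes, hence so does the least one,
   mu_Sigma. *)
Lemma mu_gt0 : lt_pS Rel [set: Sig] p -> forall S, 0 < mu Rel S p.
Proof.
(* The default 1 is the common value of all [mu Rel S] at 0, so [m 0] is 1. *)
move=> p_lt; pose m (t : R) : R := \big[Num.min/1]_(S : {set Sig}) mu Rel S t.
have m_cont : continuous m.
  move=> t; rewrite /m; elim: (index_enum _) => [|S s IHs].
    under eq_fun do rewrite big_nil.
    exact: cvg_cst.
  under eq_fun do rewrite big_cons.
  by apply: continuous_min => //; exact: mu_continuous.
suff m_gt0 : 0 < m p.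
  by move=> S; apply: lt_le_trans m_gt0 _; exact: bigmin_le.
rewrite ltNge; apply/negP => mp.
have m0 : m 0 = 1.
  by apply: bigmin_eq_id => S _; rewrite mu_at0.
have [|t /[!in_itv]/= t0p mt] :=
    @IVT R m 0 p 0 (ltW p_gt0) (continuous_subspaceT m_cont).
  by rewrite m0 ge_min mp orbT le_max ler01.
have mu0 S : 0 <= mu Rel S t by rewrite -mt; exact: bigmin_le.
have [t0 _] := andP t0p.
have : 0 < m t.
  apply/bigmin_gtP; split=> // S _; apply: lt_le_trans (mu_setT_le t0 mu0 S).
  by rewrite lt_neqAle eq_sym mu_setT_neq0 ?mu0.
by rewrite mt ltxx.
Qed.

End Positivity.
End CliquePolynomials.

(** * Generating series *)

(** One inequality comes from finite partial sums; for positive [c], the same inequality for [c^-1]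
    gives the converse. *)
Lemma ge0_esumZl (R : realType) (I : choiceType) (E : set I) (c : R)
    (f : I -> \bar R) : 0 <= c -> (forall i, (0 <= f i)%E) ->
  \esum_(i in E) (c%:E * f i)%E = (c%:E * \esum_(i in E) f i)%E.
Proof.
move=> c0 f0.
have le (d : R) (g : I -> \bar R) : 0 <= d -> (forall i, (0 <= g i)%E) ->
    (\esum_(i in E) (d%:E * g i)%E <= d%:E * \esum_(i in E) g i)%E.
  move=> d0 g0; apply: ge_ereal_sup => _ [X [finX XE] <-].
  rewrite -ge0_mule_fsumr //; apply: lee_wpmul2l; first by rewrite lee_fin.
  by apply: esum_ge; exists X.
move: (c0); rewrite le0r => /orP[/eqP->|c_gt0].
  by rewrite mul0e esum1 // => i _; rewrite mul0e.
apply/eqP; rewrite eq_le le //= -lee_pdivlMl //.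
apply: le_trans (le c^-1 _ _ _); last 2 first.
- by rewrite invr_ge0 ltW.
- by move=> i; rewrite mule_ge0 // lee_fin ltW.
by apply: le_esum => i _; rewrite muleA -EFinM mulVf ?mul1e ?gt_eqF.
Qed.

Section Series.
Local Open Scope classical_set_scope.
Variables (Sig : finType) (Rel : rel Sig).
Hypotheses (Rrefl : reflexive Rel) (Rsym : symmetric Rel).
Variables (R : realType) (p : R).
Hypothesis p_gt0 : 0 < p.
Implicit Types (a b c : Sig) (S T : {set Sig}).
Implicit Types (E F X Y Z : set (trace Rel)) (x y z : trace Rel).

Let tr a : trace Rel := tr_of Rel [:: a].

(** Extended real values allow computing before convergence is known. *)
Definition gsum E : \bar R := \esum_(x in E) (p ^+ tlen x)%:E.

Lemma wt_ge0 x : (0 <= (p ^+ tlen x)%:E)%E.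
Proof. by rewrite lee_fin exprn_ge0 ?ltW. Qed.

Lemma gsum_ge0 E : (0 <= gsum E)%E.
Proof. by apply: esum_ge0 => x _; exact: wt_ge0. Qed.

Lemma eq_gsum E F : (forall x, E x <-> F x) -> gsum E = gsum F.
Proof. by move=> EF; congr gsum; apply/seteqP; split=> x /EF. Qed.

Lemma gsumID F E : gsum E = (gsum (E `&` F) + gsum (E `&` ~` F))%E.
Proof. by apply: esumID => x _; exact: wt_ge0. Qed.

Lemma le_gsum E F : E `<=` F -> (gsum E <= gsum F)%E.
Proof.
move=> EF; rewrite (gsumID E F) [F `&` E]setIidr //; apply: leeDl.
exact: gsum_ge0.
Qed.

Lemma gsum_set1 x : gsum [set x] = (p ^+ tlen x)%:E.
Proof. by apply: esum_set1; exact: wt_ge0. Qed.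

Lemma gsum_set0 : gsum set0 = 0%E.
Proof. exact: esum_set0. Qed.

(** Unique factorization reindexes the sum over pairs, and lengths add. The sum over [Y] is taken
    finite so that it factors out as a real scalar. *)
Lemma gsum_mul X Y Z (c : R) :
  (forall x x' y y', X x -> X x' -> Y y -> Y y' ->
    tmul x y = tmul x' y' -> x = x' /\ y = y') ->
  (forall z, Z z <-> exists x y, [/\ X x, Y y & z = tmul x y]) ->
  gsum Y = c%:E -> gsum Z = (c%:E * gsum X)%E.
Proof.
move=> inj ZE Yc; have c0 : 0 <= c by rewrite -lee_fin -Yc gsum_ge0.
rewrite /gsum (reindex_esum (X `*` Y) Z (fun xy => tmul xy.1 xy.2)); last first.
  split=> [[x y] /= [Xx Yy]||z /ZE[x [y [Xx Yy ->]]]].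
  - by apply/ZE; exists x, y.
  - move=> [x y] [x' y']; rewrite !inE /= => -[Xx Yy] [Xx' Yy'] xy.
    by have [-> ->] := inj _ _ _ _ Xx Xx' Yy Yy' xy.
  - by exists (x, y).
rewrite -(ge0_esumZl _ c0 wt_ge0) -Yc /gsum.
transitivity (\esum_(x in X) \esum_(y in Y) (p ^+ tlen x * p ^+ tlen y)%:E).
  rewrite esum_esum //; last first.
    by move=> x y _ _; rewrite lee_fin mulr_ge0 // exprn_ge0 ?ltW.
  by apply: eq_esum => -[x y] _ /=; rewrite tlen_mul exprD.
apply: eq_esum => x _; under eq_esum do rewrite EFinM.
rewrite ge0_esumZl ?exprn_ge0 ?ltW //; last exact: wt_ge0.
by rewrite muleC.
Qed.

Lemma gsum_mull X Z x : (forall z, Z z <-> exists2 y, X y & z = tmul y x) ->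
  gsum Z = ((p ^+ tlen x)%:E * gsum X)%E.
Proof.
move=> ZE; apply: (@gsum_mul _ [set x]); last exact: gsum_set1.
  by move=> y y' _ _ _ _ -> -> /(tmulIr Rrefl Rsym) ->.
move=> z; split=> [/ZE[y Xy ->]|[y [_ [Xy -> ->]]]]; first by exists y, x.
by apply/ZE; exists y.
Qed.

(** The predicate on lengths covers both the truncated and the full series. *)
Definition tset S T (L : nat -> Prop) : set (trace Rel) :=
  fun x => [/\ inM S x, max_sub x T & L (tlen x)].

(** When [b] is maximal, write the trace as [y] times [b]: a maximal letter of [y] either stays
    maximal, hence lies in [T], or is blocked by [b], hence lies in [Lnb Rel b]. *)
Lemma gsum_tset_rec S T L b : b \in S -> b \in T ->
  gsum (tset S T L) = (gsum (tset S (T :\ b) L) +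
    p%:E * gsum (tset S (T :|: Lnb Rel b) (fun n => L n.+1)))%E.
Proof.
move=> bS bT; rewrite (gsumID (fun x => tmax x b)) addeC; congr (_ + _)%E.
  apply: eq_gsum => x; split=> [[[xS /(max_subP Rsym) xT xL] /negP xb]|].
    split=> //; apply/(max_subP Rsym) => c xc; rewrite !inE xT // andbT.
    by apply: contraNneq xb => <-.
  move=> [xS /(max_subP Rsym) xT xL]; split; first split=> //.
    by apply/(max_subP Rsym) => c /xT; rewrite !inE => /andP[].
  by move=> /xT; rewrite !inE eqxx.
have -> : p = p ^+ tlen (tr b) by rewrite tlen_tr.
apply: gsum_mull => z; split=> [[[zS /(max_subP Rsym) zT zL] /(tmaxP Rsym)[y zE]]|].
  exists y => //; move: zS zL; rewrite zE inM_mul tlen_mul tlen_tr addn1.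
  move=> /andP[yS _] yL; split=> //; apply/(max_subP Rsym) => c yc.
  rewrite !inE; case: (boolP (Rel b c)) => [|bc]; first by rewrite orbT.
  by rewrite zT // zE (tmax_mul Rsym) yc inM_tr /= !inE Rsym bc orbT.
move=> [y [yS /(max_subP Rsym) yT yL] ->]; split; last first.
  by rewrite (tmax_mul Rsym) (tmax_letter Rsym) eqxx.
split; first by rewrite inM_mul yS inM_tr /= bS.
- apply/(max_subP Rsym) => c.
  rewrite (tmax_mul Rsym) (tmax_letter Rsym) inM_tr /= !inE andbT.
  case/orP=> [/eqP<-//|/andP[/yT]].
  by rewrite !inE Rsym => /orP[//|->].
- by rewrite tlen_mul tlen_tr addn1.
Qed.

Hypothesis mu_pos : forall S, 0 < mu Rel S p.

Let muS_neq0 S : mu Rel S p != 0. Proof. by rewrite gt_eqF. Qed.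

(** This is [mu_setD1] for [S :\: (T :\ b)], rearranged to match [gsum_tset_rec]. *)
Lemma mu_setD_rec S T b : b \in S -> b \in T ->
  mu Rel (S :\: T) p =
  mu Rel (S :\: (T :\ b)) p + p * mu Rel (S :\: (T :|: Lnb Rel b)) p.
Proof.
move=> bS bT; rewrite (mu_setD1 Rrefl Rsym _ (S := S :\: (T :\ b)) (b := b)).
  have -> : (S :\: (T :\ b)) :\ b = S :\: T.
    by apply/setP => c; rewrite !inE; case: (c =P b) => [->|]; rewrite ?bT.
  have -> : (S :\: (T :\ b)) :\: Lnb Rel b = S :\: (T :|: Lnb Rel b).
    apply/setP => c; rewrite !inE negb_or andbCA andbA.
    by case: (c =P b) => [->|_] /=; rewrite ?Rrefl ?bT.
  by rewrite subrK.
by rewrite !inE eqxx bS.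
Qed.

Lemma gsum_tset_lt S T n :
  (gsum (tset S T (fun m => m < n)%N) <= (mu Rel (S :\: T) p / mu Rel S p)%:E)%E.
Proof.
elim: n T => [|n IHn] T.
  have -> : tset S T (fun m => m < 0)%N = set0 by apply/seteqP; split=> x [].
  by rewrite gsum_set0 lee_fin divr_ge0 ?ltW.
(* Inner induction: removing [b] from [T] shrinks the intersection, and the other term has smaller
   length, where [IHn] holds for every [T]. If the intersection is empty, only the empty trace
   remains. *)
have [m] := ubnP #|S :&: T|; elim: m T => // m IHm T Tm.
have [ST|[b /setIP[bS bT]]] := set_0Vmem (S :&: T).
  have -> : S :\: T = S by apply/finset.setDidPl; rewrite -finset.setI_eq0 ST.
  have -> : (mu Rel S p / mu Rel S p)%:E = gsum [set tone Rel].
    by rewrite divff // gsum_set1 tlen_tr.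
  apply: le_gsum => x [xS /(max_subP Rsym) xT _].
  case: (trace_maxP Rsym x) => // -[a xa]; suff : a \in finset.set0 by rewrite inE.
  by rewrite -ST inE (tmax_inM xS xa) xT.
rewrite (gsum_tset_rec _ bS bT) (mu_setD_rec bS bT) mulrDl EFinD.
apply: leeD.
  apply: IHm; rewrite ltnS in Tm; apply: (leq_trans _ Tm); apply: proper_card.
  apply/properP; split; first by apply: finset.setIS; exact: subD1set.
  by exists b; rewrite !inE ?bS ?bT // eqxx.
rewrite -mulrA EFinM; apply: lee_wpmul2l; first by rewrite lee_fin ltW.
exact: IHn.
Qed.

Definition MT S T := tset S T (fun=> True).

Lemma gsum_MT_le S T :
  (gsum (MT S T) <= (mu Rel (S :\: T) p / mu Rel S p)%:E)%E.
Proof.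
apply: ge_ereal_sup => _ [X [finX XM] <-].
have [s XE] := (@finite_seqP (trace Rel) X).1 finX.
(* A finite set of traces has bounded length, so the uniform bound on truncations applies. *)
apply: le_trans (gsum_tset_lt S T (\max_(x <- s) tlen x).+1).
apply: esum_ge; exists X => //; split=> // x Xx.
have [xS xT _] := XM _ Xx; split=> //; rewrite ltnS.
by apply: leq_bigmax_seq; move: Xx; rewrite XE.
Qed.

Lemma gsum_MT_fin S T : gsum (MT S T) \is a fin_num.
Proof.
rewrite ge0_fin_numE ?gsum_ge0 //; apply: le_lt_trans (gsum_MT_le S T) _.
exact: ltry.
Qed.

(** Finiteness makes the recursion an equation between reals. It determines every [w U] up to the
    factor [w S], and the value at the empty set fixes that factor. *)
Lemma gsum_MT S T : gsum (MT S T) = (mu Rel (S :\: T) p / mu Rel S p)%:E.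
Proof.
pose w T := fine (gsum (MT S T)).
have wE U : gsum (MT S U) = (w U)%:E by rewrite fineK // gsum_MT_fin.
have w_rec (U : {set Sig}) b : b \in S -> b \in U ->
    w U = w (U :\ b) + p * w (U :|: Lnb Rel b).
  move=> bS bU; have := gsum_tset_rec (fun=> True) bS bU.
  by rewrite -!/(MT _ _) !wE -EFinM -EFinD => -[].
have w_mu U : w U = mu Rel (S :\: U) p * w S.
  have [m] := ubnP #|S :\: U|; elim: m U => // m IHm U Um.
  have [SU|[b bSU]] := set_0Vmem (S :\: U).
    rewrite SU mu_set0 mul1r; congr fine; apply: eq_gsum => x.
    split=> -[xS /(max_subP Rsym) xT _]; split=> //; apply/(max_subP Rsym) => a xa.
      exact: tmax_inM xS xa.
    have : a \notin S :\: U by rewrite SU inE.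
    by rewrite inE (tmax_inM xS xa) andbT negbK.
  move: (bSU); rewrite inE => /andP[bU bS].
  have lt_m (V : {set Sig}) : b \in V -> U \subset V -> (#|S :\: V| < m)%N.
    move=> bV UV; rewrite ltnS in Um; apply: (leq_trans _ Um); apply: proper_card.
    apply/properP; split; first exact: finset.setDS.
    by exists b; rewrite // inE bV.
  have UbU : U \subset b |: U by exact: finset.subsetUr.
  have bbU : b \in b |: U by exact: finset.setU11.
  have w1 := IHm (b |: U) (lt_m _ bbU UbU).
  have w2 : w (b |: U :|: Lnb Rel b) =
      mu Rel (S :\: (b |: U :|: Lnb Rel b)) p * w S.
    apply/IHm/lt_m; first by rewrite !inE eqxx.
    exact: fintype.subset_trans UbU (finset.subsetUl _ _).
  (* The recursion is used at [b |: U] and solved for [w U]; both other terms concern larger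
     sets. *)
  have := w_rec _ b bS bbU; have := mu_setD_rec bS bbU.
  rewrite w1 w2 finset.setU1K // => ->; lra.
have w0 : w finset.set0 = 1.
  suff -> : w finset.set0 = fine (gsum [set tone Rel]).
    by rewrite gsum_set1 tlen_tr.
  congr fine; apply: eq_gsum => x; split=> [[xS /(max_subP Rsym) x0 _]|->].
    by case: (trace_maxP Rsym x) => // -[a /x0]; rewrite inE.
  split=> //; first exact: inM1.
  by apply/(max_subP Rsym) => a; rewrite (tmax1 Rsym).
rewrite wE w_mu; congr EFin; congr (_ * _).
apply: (mulfI (muS_neq0 S)); rewrite divff //.
by rewrite -w0 (w_mu finset.set0) finset.setD0.
Qed.

(** * From weighted sums to probabilities *)

Lemma Pr_weights (P : trace Rel -> R) F E (c : R) : 0 <= c ->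
  (forall x, F x -> P x = c * p ^+ tlen x) -> (forall x, ~ F x -> P x = 0) ->
  Pr P E = c * fine (gsum (E `&` F)).
Proof.
move=> c0 PF PnF; rewrite /Pr.
have -> : \esum_(x in E) (P x)%:E = (c%:E * gsum (E `&` F))%E.
  rewrite /gsum esum_mkcondr -ge0_esumZl //; last first.
    by move=> x; case: ifP => // _; exact: wt_ge0.
  apply: eq_esum => x _; case: ifPn => [/set_mem/PF->//|/negP nF].
  by rewrite mule0 PnF // => /mem_set.
move: c0; rewrite le0r => /orP[/eqP->|c0]; first by rewrite mul0e mul0r.
(* If the sum is infinite, [fine] sends both sides to 0. *)
have := gsum_ge0 (E `&` F); case: gsum => //= _.
by rewrite gt0_muley ?mulr0 // lte_fin.
Qed.

Lemma gsum_MT1 S T x (B : set (trace Rel)) : (forall y, B y <-> y = x) ->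
  gsum (B `&` MT S T) = (if `[< MT S T x >] then p ^+ tlen x else 0)%:E.
Proof.
move=> Bx; case: asboolP => [xM|xNM].
  rewrite -gsum_set1; apply: eq_gsum => y; split=> [[/Bx]//|->].
  by split=> //; exact/Bx.
by rewrite -[RHS]gsum_set0; apply: eq_gsum => y; split=> [[/Bx-> /xNM]|].
Qed.

Lemma Pr_Bpmf S T E :
  Pr (Bpmf Rel S p) (E `&` (fun x => max_sub x T)) =
  mu Rel S p * fine (gsum (E `&` MT S T)).
Proof.
rewrite (@Pr_weights _ (fun x => inM S x) _ (mu Rel S p)) ?ltW //.
- congr (_ * fine _); apply: eq_gsum => x.
  by split=> [[[Ex xT] xS]|[Ex [xS xT _]]].
- by move=> x xS; rewrite /Bpmf xS.
- by move=> x /negP/negPf xS; rewrite /Bpmf xS.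
Qed.

(** The conditioning event has probability [mu Rel (S :\: T) p]. *)
Lemma DpmfE S T x : Dpmf Rel S T p x =
  mu Rel S p / mu Rel (S :\: T) p * (if `[< MT S T x >] then p ^+ tlen x else 0).
Proof.
rewrite /Dpmf /condPr Pr_Bpmf (@gsum_MT1 _ _ x) //=.
rewrite -[X in Pr _ X]setTI Pr_Bpmf setTI gsum_MT /=.
by rewrite [mu Rel S p * (_ / _)]mulrC divfK // mulrAC.
Qed.

Lemma Pr_Dpmf S T E : Pr (Dpmf Rel S T p) E =
  mu Rel S p / mu Rel (S :\: T) p * fine (gsum (E `&` MT S T)).
Proof.
apply: Pr_weights => [|x xM|x xM]; first by rewrite divr_ge0 ?ltW.
  by rewrite DpmfE asboolT.
by rewrite DpmfE asboolF ?mulr0.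
Qed.

End Series.

(** * Pyramidal decomposition of the series *)

Section PyramidalSeries.
Local Open Scope classical_set_scope.
Variables (Sig : finType) (Rel : rel Sig).
Hypotheses (Rrefl : reflexive Rel) (Rsym : symmetric Rel).
Variables (R : realType) (p : R) (a1 : Sig).
Hypotheses (p_gt0 : 0 < p) (mu_pos : forall S, 0 < mu Rel S p).
Variable T : {set Sig}.
Hypothesis a1T : a1 \in T.
Implicit Types (B : set (trace Rel)) (A : nat -> set (trace Rel)).

Let S1 : {set Sig} := ~: [set a1]%SET.
Local Notation gs := (@gsum Sig Rel R p).

Definition pyr_in B : set (trace Rel) := fun u => Pyr Rel a1 u /\ B u.

Definition pyrdec_in A k : set (trace Rel) := fun x =>
  [/\ Kdec Rel a1 x = k, forall i, (i <= k)%N -> A i (Udec Rel a1 i x)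
    & max_sub x T].

Lemma gsum_pyr_in B : gs (pyr_in B) =
  (p%:E * gs ([set w | B (tmul w (tr_of Rel [:: a1]))] `&`
              MT S1 (Lnb Rel a1)))%E.
Proof.
rewrite -[p in p%:E]expr1 -[1%N](tlen_tr Rel [:: a1]).
apply: (gsum_mull Rrefl Rsym p_gt0) => u.
split=> [[/PyrP[w [wS wL] ->] Bu]|[w [Bw [wS wL _]] ->]]; first by exists w.
by split=> //; apply/PyrP; exists w.
Qed.

Lemma gsum_sub_fin B S U : B `<=` MT S U -> gs B \is a fin_num.
Proof.
move=> BM; rewrite ge0_fin_numE ?gsum_ge0 //.
apply: le_lt_trans (le_gsum p_gt0 BM) _.
by rewrite -ge0_fin_numE ?gsum_ge0 // gsum_MT_fin.
Qed.

Lemma gsum_pyr_in_fin B : gs (pyr_in B) \is a fin_num.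
Proof.
rewrite gsum_pyr_in fin_numM //; apply: gsum_sub_fin; exact: subIsetr.
Qed.

(** Induction on [k]: split off the first pyramid and apply the hypothesis to the shifted family of
    sets. As [a1] lies in [T], the condition on maximal letters passes to the remaining factor. *)
Lemma gsum_pyrdec_in A k : gs (pyrdec_in A k) =
  (\prod_(i < k) fine (gs (pyr_in (A i))) *
   fine (gs (A k `&` MT S1 T)))%:E.
Proof.
elim: k A => [|k IHk] A.
  rewrite big_ord0 mul1r fineK; last by apply: gsum_sub_fin; exact: subIsetr.
  apply: eq_gsum => x; split=> [[K0 Ax xT]|[Ax [xS xT _]]].
    have xS : inM S1 x by rewrite inMC1 -(Kdec_count Rsym) K0.
    by split=> //; have := Ax 0%N isT; rewrite /Udec (pyrdec1 Rrefl Rsym xS).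
  split=> // [|[|//] _].
    by rewrite (Kdec_count Rsym); apply/eqP; rewrite -inMC1.
  by rewrite /Udec (pyrdec1 Rrefl Rsym xS).
rewrite big_ord_recl -mulrA mulrC EFinM fineK ?gsum_pyr_in_fin //.
apply: (gsum_mul p_gt0 _ _ (IHk (fun i => A i.+1))).
  move=> u u' y y' [Pu _] [Pu' _] _ _; exact: (Pyr_mul_inj Rrefl Rsym Pu Pu').
move=> z; split=> [[zk Az zT]|[u [y [[Pu Au] [yk Ay yT] ->]]]].
  have [|u [y [Pu zE]]] := @exists_Pyr _ _ Rsym a1 z.
    by rewrite -(Kdec_count Rsym) zk.
  exists u, y; split=> //.
    split=> //; have := Az 0%N isT.
    by rewrite zE /Udec (pyrdec_mul Rrefl Rsym y Pu).
  split=> [|i ik|].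
  - move: zk; rewrite zE !(Kdec_count Rsym) tcount_mul.
    by rewrite (tcount_Pyr Pu) => -[].
  - by have := Az i.+1 ik; rewrite zE /Udec (pyrdec_mul Rrefl Rsym y Pu).
  - by apply/(max_sub_Pyr_mul Rrefl Rsym y Pu a1T); rewrite -zE.
split.
- by rewrite (Kdec_count Rsym) tcount_mul (tcount_Pyr Pu) -(Kdec_count Rsym) yk.
- by move=> [|i] ik; rewrite /Udec (pyrdec_mul Rrefl Rsym y Pu) //; exact: Ay.
- exact/(max_sub_Pyr_mul Rrefl Rsym y Pu a1T).
Qed.

(** * The law of the decomposition *)

Let Z := mu Rel (S1 :\: T) p.
Let V := mu Rel (~: Lnb Rel a1) p.
Let M1 := mu Rel S1 p.
Let M := mu Rel [set: Sig]%SET p.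
Let r := p * V / M1.

Lemma setC_Lnb : S1 :\: Lnb Rel a1 = ~: Lnb Rel a1.
Proof.
apply/setP => b; rewrite !inE; case: (b =P a1) => [->|_]; first by rewrite Rrefl.
by rewrite andbT.
Qed.

(** The clique recursion removing [a1] from the whole alphabet, divided by [M1]. *)
Lemma pyr_ratioE : r = 1 - M / M1.
Proof.
rewrite /r /M (mu_setD1 Rrefl Rsym _ (finset.in_setT a1)).
have -> : [set: Sig]%SET :\ a1 = S1 by rewrite finset.setTD.
have -> : [set: Sig]%SET :\: Lnb Rel a1 = ~: Lnb Rel a1 by rewrite finset.setTD.
by rewrite -/M1 -/V; field; rewrite gt_eqF ?mu_pos.
Qed.

Let D := Dpmf Rel [set: Sig]%SET T p.
Let K := Kdec Rel a1.
Let U := Udec Rel a1.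
(** [rho] and [sig] are the prospective conditional laws of a pyramid and of the last factor; the
    divisors are their total weights. *)
Let rho B := fine (gs (pyr_in B)) / r.
Let sig B := fine (gs (B `&` MT S1 T)) / (Z / M1).

Let r_gt0 : 0 < r. Proof. by rewrite /r divr_gt0 ?mulr_gt0 ?mu_pos. Qed.

Let s_gt0 : 0 < Z / M1. Proof. by rewrite divr_gt0 ?mu_pos. Qed.

(** Identifies [r] as the generating series of pyramids at [p]. *)
Lemma gsum_pyrT : fine (gs (pyr_in setT)) = r.
Proof.
rewrite gsum_pyr_in (_ : [set w | _] = setT) // setTI (gsum_MT Rrefl Rsym) //=.
by rewrite setC_Lnb mulrA.
Qed.

(** The normalizing constant [M / Z] of [D] times the total weight [Z / M1] of the last factor is
    [M / M1], that is [1 - r]; each pyramid brings a factor [r]. *)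
Lemma Pr_pyrdec A k :
  Pr D ((fun x => forall i, (i <= k)%N -> A i (U i x)) `&` (fun x => K x = k)) =
  (1 - r) * r ^+ k * (\prod_(i < k) rho (A i) * sig (A k)).
Proof.
rewrite (Pr_Dpmf Rrefl Rsym) //.
have -> : [set: Sig]%SET :\: T = S1 :\: T.
  apply/setP => b; rewrite !inE andbC.
  case: (b =P a1) => [->|_]; last by rewrite andbT.
  by rewrite a1T.
rewrite (_ : gsum p _ = gs (pyrdec_in A k)); last first.
  apply: eq_gsum => x; split=> [[[xA xk] [_ xT _]]|[xk xA xT]]; first by [].
  by split=> //; split=> //; exact: inMT.
have rk : r ^+ k != 0 by rewrite expf_neq0 // gt_eqF.
have -> : 1 - r = M / M1 by rewrite pyr_ratioE subKr.
rewrite gsum_pyrdec_in /= /rho big_split /= prodr_const card_ord /sig exprVn.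
rewrite -/Z -/M; set P := \prod_(i < k) _; set q := r ^+ k; set g := fine _.
field; rewrite rk !gt_eqF //; exact: mu_pos.
Qed.

Lemma rhoT : rho setT = 1.
Proof. by rewrite /rho gsum_pyrT divff // gt_eqF. Qed.

Lemma sigT : sig setT = 1.
Proof. by rewrite /sig setTI gsum_MT //= divff // gt_eqF. Qed.

Lemma Pr_K k : Pr D (fun x => K x = k) = (1 - r) * r ^+ k.
Proof.
have := Pr_pyrdec (fun=> setT) k.
rewrite sigT big1 ?mulr1 => [<-|i _]; last exact: rhoT.
by congr Pr; apply/seteqP; split=> // x [].
Qed.

Lemma Pr_K_neq0 k : Pr D (fun x => K x = k) != 0.
Proof.
rewrite Pr_K mulf_neq0 ?expf_neq0 ?(gt_eqF r_gt0) // pyr_ratioE subKr.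
by rewrite gt_eqF // divr_gt0 ?mu_pos.
Qed.

Lemma condPr_pyrdec A k :
  condPr D (fun x => forall i, (i <= k)%N -> A i (U i x)) (fun x => K x = k) =
  \prod_(i < k) rho (A i) * sig (A k).
Proof.
by rewrite /condPr Pr_pyrdec -Pr_K mulrC mulKf ?Pr_K_neq0.
Qed.

Lemma condPr_factor B k i : (i <= k)%N ->
  condPr D (fun x => B (U i x)) (fun x => K x = k) =
  if (i < k)%N then rho B else sig B.
Proof.
(* Constraining only the [i]-th factor makes all other factors of the product 1. *)
move=> ik; pose A j : set (trace Rel) := if j == i then B else setT.
have -> : (fun x => B (U i x)) = (fun x => forall j, (j <= k)%N -> A j (U j x)).
  apply/seteqP; split=> x /= => [Bx j jk|/(_ i ik)]; rewrite /A ?eqxx //.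
  by case: eqP => [->|].
rewrite condPr_pyrdec /A; case: ltnP => [lt_ik|ki].
  rewrite gtn_eqF // sigT mulr1 (bigD1 (Ordinal lt_ik)) //= eqxx.
  by rewrite big1 ?mulr1 // => j /negPf; rewrite -val_eqE /= => ->; exact: rhoT.
have -> : k = i by apply/eqP; rewrite eqn_leq ki ik.
rewrite eqxx big1 ?mul1r // => j _; rewrite ltn_eqF; [exact: rhoT|exact: ltn_ord].
Qed.

(** The joint law is already a product, whose factors are the marginals by [condPr_factor]. *)
Lemma condPr_indep A k :
  condPr D (fun x => forall i, (i <= k)%N -> A i (U i x)) (fun x => K x = k) =
  \prod_(i < k.+1) condPr D (fun x => A i (U i x)) (fun x => K x = k).
Proof.
rewrite condPr_pyrdec big_ord_recr /= condPr_factor // ltnn; congr (_ * _).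
by apply: eq_bigr => i _; rewrite condPr_factor ?ltn_ord // ltnW.
Qed.

(** The weight [p] of the apex cancels the [p] in [r], leaving the normalizing constant [M1 / V]. *)
Lemma condPr_rdiv k i w : (i < k)%N ->
  condPr D (fun x => rdiv Rel a1 (U i x) = w) (fun x => K x = k) =
  Dpmf Rel S1 (Lnb Rel a1) p w.
Proof.
move=> ik; rewrite (condPr_factor (fun u => rdiv Rel a1 u = w) (ltnW ik)) ik.
rewrite /rho gsum_pyr_in (DpmfE Rrefl Rsym) // setC_Lnb -/V -/M1.
rewrite (@gsum_MT1 _ _ _ _ _ _ _ w) //=; last first.
  by move=> y /=; rewrite (rdiv_mul Rrefl Rsym).
set g := if _ then _ else _.
by rewrite /r; field; rewrite ?gt_eqF ?mu_pos.
Qed.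

Lemma condPr_last k w :
  condPr D (fun x => U k x = w) (fun x => K x = k) = Dpmf Rel S1 T p w.
Proof.
rewrite (condPr_factor (fun u => u = w) (leqnn k)) ltnn /sig.
rewrite (DpmfE Rrefl Rsym) // -/Z -/M1 (@gsum_MT1 _ _ _ _ _ _ _ w) //=.
by rewrite invf_div mulrC.
Qed.

End PyramidalSeries.

Unset Implicit Arguments.

Theorem theorem1p7 (Sig : finType) (Rel : rel Sig)
    (Rrefl : reflexive Rel) (Rsym : symmetric Rel)
    (R : realType) (p : R) (p_gt0 : 0 < p) (p_lt : lt_pS Rel [set: Sig] p)
    (a1 : Sig) :
  let r := p * mu Rel (~: Lnb Rel a1) p / mu Rel [set~ a1] p in
  [/\ 0 < mu Rel [set~ a1] p,
      r = 1 - mu Rel [set: Sig] p / mu Rel [set~ a1] p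
    & forall T : {set Sig}, a1 \in T ->
      let D := Dpmf Rel [set: Sig] T p in
      let K := Kdec Rel a1 in
      let U := Udec Rel a1 in
      (* (1) K is geometric with parameter r *)
      (forall k : nat, Pr D (fun x => K x = k) = (1 - r) * r ^+ k) /\
      (* (2) conditionally on K = k *)
      (forall k : nat,
        (* (a) U_0, ..., U_k are independent *)
        (forall A : nat -> set (trace Rel),
           condPr D (fun x => forall i, (i <= k)%N -> A i (U i x))
                    (fun x => K x = k)
           = \prod_(i < k.+1) condPr D (fun x => A i (U i x)) (fun x => K x = k))
        /\
        (* (b) U_i . a1^{-1} has law D^p_{Sig \ a1, L(a1)} for i < k *)
        (forall (i : nat) (w : trace Rel), (i < k)%N ->
           condPr D (fun x => rdiv Rel a1 (U i x) = w) (fun x => K x = k)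
           = Dpmf Rel [set~ a1] (Lnb Rel a1) p w)
        /\
        (* (c) U_k has law D^p_{Sig \ a1, T} *)
        (forall w : trace Rel,
           condPr D (fun x => U k x = w) (fun x => K x = k)
           = Dpmf Rel [set~ a1] T p w))].
Proof.
have mu_pos := mu_gt0 Rrefl Rsym p_gt0 p_lt.
move=> r; split=> [||T a1T D K U]; first exact: mu_pos.
  exact: pyr_ratioE.
split=> k; first exact: Pr_K.
split; first by move=> A; exact: condPr_indep.
by split=> [i w ik|w]; [exact: condPr_rdiv|exact: condPr_last].
Qed.
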